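(* Let $L, W$ be sets and $\Lambda: L \times W \to \mathbf{R}$ a function. Suppose the collection $(\lambda_l)_{l\in L}$ of functions $\lambda_l:W\to\mathbf{R}$, $\lambda_l(w) = \Lambda(l,w)$, is bounded and totally bounded with respect to the supremum norm on functions $W \to \mathbf{R}$. Then the persistence module $\mathrm{H}(\mathbb{D}\mathrm{ow}(\Lambda))$ is q-tame.
   Context: Fix a field $\mathbf{k}$; $\mathrm{H}$ denotes (total) simplicial homology with coefficients in $\mathbf{k}$. A persistence module $\mathbb{V}$ is a family of $\mathbf{k}$-vector spaces $(V_a)_{a\in\mathbf{R}}$ with linear maps $v_a^b:V_a\to V_b$ for $a\le b$ such that $v_a^a=\mathrm{id}$ and $v_b^c\circ v_a^b=v_a^c$ for $a\le b\le c$. It is q-tame if $\mathrm{rank}(v_a^b)<\infty$ whenever $a<b$. Totally bounded means: for every $\varepsilon>0$ there is a finite $F\subseteq L$ such that every $l\in L$ has some $l'\in F$ with $\|\lambda_l-\lambda_{l'}\|_\infty<\varepsilon$. For $a\in\mathbf{R}$, the Dowker complex $\mathrm{Dow}(\Lambda,a)$ is the simplicial complex whose simplices are the nonempty finite subsets $\sigma\subseteq L$ for which there exists $w\in W$ with $\Lambda(l,w)\le a$ for all $l\in\sigma$. $\mathrm{H}(\mathbb{D}\mathrm{ow}(\Lambda))$ is the persistence module $(\mathrm{H}(\mathrm{Dow}(\Lambda,a)))_{a\in\mathbf{R}}$ with maps induced by inclusions. *)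

(* Defs.v *)
From HB Require Import structures.
From mathcomp Require Import all_boot all_order all_fingroup all_algebra.
From mathcomp Require Import mathcomp_extra boolp classical_sets functions.
From mathcomp Require Import cardinality fsbigop reals ereal.

Set Implicit Arguments.
Unset Strict Implicit.
Unset Printing Implicit Defensive.

Import Order.TTheory GRing.Theory Num.Theory.

Local Open Scope classical_set_scope.
Local Open Scope ring_scope.

Section Subquotient.
Variables (k : fieldType) (V : lmodType k).

Record submod (Z : submodClosed V) := Submod {
  submod_val :> V;
  submod_valP : submod_val \in Z }.

HB.instance Definition _ (Z : submodClosed V) :=
  [isSub for @submod_val Z].
HB.instance Definition _ (Z : submodClosed V) := [Choice of submod Z by <:].
HB.instance Definition _ (Z : submodClosed V) :=
  [SubChoice_isSubLmodule of submod Z by <:].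

Variables Z B : submodClosed V.

Definition submod_pred : {pred submod Z} := fun z => submod_val z \in B.

Lemma submod_pred_closed : submod_closed submod_pred.
Proof.
split=> [|a x y xB yB]; first exact: (rpred0 B).
by apply: (@rpredD _ B) => //; apply: (@rpredZ _ _ B).
Qed.

HB.instance Definition _ :=
  GRing.isSubmodClosed.Build k (submod Z) submod_pred submod_pred_closed.

(* Z / (Z `&` B), with the scaling that the library quotient, which is only
   a zmodType, lacks. *)
Definition subquot := Quotient.quot submod_pred.

HB.instance Definition _ := GRing.Zmodule.on subquot.

Definition subquot_pi (z : submod Z) : subquot :=
  (\pi_(Quotient.quot submod_pred) z)%qT.

Lemma subquot_piP (x y : submod Z) :
  reflect (subquot_pi x = subquot_pi y) (submod_val x - submod_val y \in B).
Proof.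
have -> : (submod_val x - submod_val y \in B) = (x - y \in submod_pred) by [].
by rewrite Quotient.idealrBE; apply: eqP.
Qed.

Lemma subquot_pi_repr (q : subquot) : subquot_pi (generic_quotient.repr q) = q.
Proof. by rewrite /subquot_pi generic_quotient.reprK. Qed.

Lemma subquot_piD x y : subquot_pi (x + y) = subquot_pi x + subquot_pi y.
Proof. exact: raddfD. Qed.

Definition subquot_scale (a : k) (q : subquot) : subquot :=
  subquot_pi (a *: generic_quotient.repr q).

Lemma subquot_scale_pi a z :
  subquot_scale a (subquot_pi z) = subquot_pi (a *: z).
Proof.
apply/subquot_piP; set x := generic_quotient.repr _.
have -> : submod_val (a *: x) - submod_val (a *: z) =
          a *: (submod_val x - submod_val z) by rewrite scalerBr.
by apply/rpredZ/subquot_piP; rewrite subquot_pi_repr.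
Qed.

Lemma subquot_scaleA a b q :
  subquot_scale a (subquot_scale b q) = subquot_scale (a * b) q.
Proof. by rewrite -[q]subquot_pi_repr !subquot_scale_pi scalerA. Qed.

Lemma subquot_scale1 : left_id 1 subquot_scale.
Proof. by move=> q; rewrite -[q]subquot_pi_repr subquot_scale_pi scale1r. Qed.

Lemma subquot_scaleDr : right_distributive subquot_scale +%R.
Proof.
move=> a p q; rewrite -[q]subquot_pi_repr -[p]subquot_pi_repr.
by rewrite -subquot_piD !subquot_scale_pi scalerDr subquot_piD.
Qed.

Lemma subquot_scaleDl q : {morph subquot_scale^~ q : a b / a + b}.
Proof.
move=> a b; rewrite -[q]subquot_pi_repr !subquot_scale_pi.
by rewrite scalerDl subquot_piD.
Qed.

HB.instance Definition _ := GRing.Zmodule_isLmodule.Build k subquot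
  subquot_scaleA subquot_scale1 subquot_scaleDr subquot_scaleDl.

Lemma subquot_pi_is_linear : linear subquot_pi.
Proof. by move=> a x y; rewrite subquot_piD -subquot_scale_pi. Qed.

HB.instance Definition _ :=
  GRing.isLinear.Build k (submod Z) subquot *:%R subquot_pi
    subquot_pi_is_linear.

End Subquotient.

Section SubquotientMap.
Variables (k : fieldType) (V : lmodType k) (Z B Z' B' : submodClosed V).
Hypotheses (ZZ' : {subset Z <= Z'}) (BB' : {subset B <= B'}).

Definition submod_incl (z : submod Z) : submod Z' :=
  Submod (ZZ' (submod_valP z)).

#[using="BB'"]
Definition subquot_map (q : subquot Z B) : subquot Z' B' :=
  subquot_pi B' (submod_incl (generic_quotient.repr q)).

Lemma subquot_map_pi z :
  subquot_map (subquot_pi B z) = subquot_pi B' (submod_incl z).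
Proof.
apply/subquot_piP/BB'; rewrite /=.
by apply/subquot_piP; rewrite subquot_pi_repr.
Qed.

Lemma subquot_map_is_linear : linear subquot_map.
Proof.
move=> a p q; rewrite -[q]subquot_pi_repr -[p]subquot_pi_repr.
rewrite -linearP !subquot_map_pi -linearP; congr subquot_pi.
exact/val_inj.
Qed.

HB.instance Definition _ := GRing.isLinear.Build k _ _ _ subquot_map
  subquot_map_is_linear.

End SubquotientMap.

Arguments subquot_map {k V Z B Z' B'} ZZ' BB' q.

Section DirectSum.
Variables (k : fieldType) (I : Type) (V : I -> lmodType k).

Record dsum := Dsum {
  dsum_val :> forall i, V i;
  dsum_valP : finite_set [set i | dsum_val i <> 0] }.

HB.instance Definition _ := gen_eqMixin dsum.
HB.instance Definition _ := gen_choiceMixin dsum.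

Lemma dsumP (f g : dsum) : (forall i, f i = g i) -> f = g.
Proof.
case: f g => [f fP] [g gP] /= fg; have E := functional_extensionality_dep fg.
by case: _ / E in gP fg *; congr Dsum; exact: Prop_irrelevance.
Qed.

Lemma dsum0_subproof : finite_set [set i | (0 : V i) <> 0].
Proof. by rewrite (_ : [set _ | _] = set0) // -subset0 => i /=. Qed.
Definition dsum0 := Dsum dsum0_subproof.

Lemma dsumD_subproof (f g : dsum) : finite_set [set i | f i + g i <> 0].
Proof.
apply: (sub_finite_set (B := [set i | f i <> 0] `|` [set i | g i <> 0])).
  move=> i /= fg0; have [fi0|] := pselect (f i = 0); [right|by left].
  by move=> gi0; apply: fg0; rewrite fi0 gi0 addr0.
by rewrite finite_setU; split; exact: dsum_valP.
Qed.
Definition dsumD f g := Dsum (dsumD_subproof f g).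

Lemma dsumN_subproof (f : dsum) : finite_set [set i | - f i <> 0].
Proof.
apply: sub_finite_set (dsum_valP f) => i /= fi0 f0.
by apply: fi0; rewrite f0 oppr0.
Qed.
Definition dsumN f := Dsum (dsumN_subproof f).

Lemma dsumZ_subproof a (f : dsum) : finite_set [set i | a *: f i <> 0].
Proof.
apply: sub_finite_set (dsum_valP f) => i /= fi0 f0.
by apply: fi0; rewrite f0 scaler0.
Qed.
Definition dsumZ a f := Dsum (dsumZ_subproof a f).

Lemma dsumDA : associative dsumD.
Proof. by move=> f g h; apply: dsumP => i /=; rewrite addrA. Qed.
Lemma dsumDC : commutative dsumD.
Proof. by move=> f g; apply: dsumP => i /=; rewrite addrC. Qed.
Lemma dsum0D : left_id dsum0 dsumD.
Proof. by move=> f; apply: dsumP => i /=; rewrite add0r. Qed.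
Lemma dsumND : left_inverse dsum0 dsumN dsumD.
Proof. by move=> f; apply: dsumP => i /=; rewrite addNr. Qed.

HB.instance Definition _ :=
  GRing.isZmodule.Build dsum dsumDA dsumDC dsum0D dsumND.

Lemma dsumZA a b f : dsumZ a (dsumZ b f) = dsumZ (a * b) f.
Proof. by apply: dsumP => i /=; rewrite scalerA. Qed.
Lemma dsum1Z : left_id 1 dsumZ.
Proof. by move=> f; apply: dsumP => i /=; rewrite scale1r. Qed.
Lemma dsumZDr : right_distributive dsumZ +%R.
Proof. by move=> a f g; apply: dsumP => i /=; rewrite scalerDr. Qed.
Lemma dsumZDl f : {morph dsumZ^~ f : a b / a + b}.
Proof. by move=> a b; apply: dsumP => i /=; rewrite scalerDl. Qed.

HB.instance Definition _ :=
  GRing.Zmodule_isLmodule.Build k dsum dsumZA dsum1Z dsumZDr dsumZDl.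

End DirectSum.

Section DirectSumMap.
Variables (k : fieldType) (I : Type) (V W : I -> lmodType k).
Variable f : forall i, {linear V i -> W i}.

Lemma dsum_map_subproof (x : dsum V) : finite_set [set i | f i (x i) <> 0].
Proof.
apply: sub_finite_set (dsum_valP x) => i /= fi0 x0.
by apply: fi0; rewrite x0 linear0.
Qed.
Definition dsum_map x : dsum W := Dsum (dsum_map_subproof x).

Lemma dsum_map_is_linear : linear dsum_map.
Proof. by move=> a x y; apply: dsumP => i /=; rewrite linearP. Qed.

HB.instance Definition _ :=
  GRing.isLinear.Build k _ _ _ dsum_map dsum_map_is_linear.

End DirectSumMap.

(* An abstract simplicial complex with vertices in L; elements of L need not
   be vertices of the complex. *)
Record simplicial_complex (L : Type) := SimplicialComplex {
  simplex :> set (set L);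
  simplex_finite : forall s, simplex s -> finite_set s;
  simplex_neq0 : forall s, simplex s -> s !=set0;
  simplex_face : forall s t,
    simplex s -> t `<=` s -> t !=set0 -> simplex t }.

Section Chains.
Variables (k : fieldType) (L : Type).

(* An oriented simplicial n-chain of K is a function on ordered n-simplices
   of K that is finitely supported and alternates under reordering of the
   vertices.  It is extended by zero to all (n+1)-tuples of elements of L, so
   that the chains of every complex on L lie in the same space. *)
Notation tuplefun n := (('I_n.+1 -> L) -> k^o).

Definition chains (K : set (set L)) n : {pred tuplefun n} := fun c =>
  `[< [/\ finite_set [set v | c v <> 0],
          forall (s : 'S_n.+1) v, c (v \o s) = (-1) ^+ s * c v
        & forall v, c v <> 0 -> injective v /\ K (range v)] >].
Arguments chains : clear implicits.

Definition fcons n (x : L) (v : 'I_n.+1 -> L) : 'I_n.+2 -> L :=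
  fun i => if unlift ord0 i is Some j then v j else x.

(* The linear extension of [v0,...,vn] |-> \sum_i (-1)^i [v0,...,^vi,...,vn]
   in terms of coefficients; boundary_ochain recovers the usual formula. *)
Definition simplicial_boundary n (c : tuplefun n.+1) : tuplefun n :=
  fun v => \sum_(x \in [set: {classic L}]) c (fcons x v).

(* The oriented simplex [v0,...,vn] as a chain: by the Leibniz formula its
   value is the sign of s at v \o s, and 0 elsewhere. *)
Definition ochain n (v : 'I_n.+1 -> L) : tuplefun n := fun w =>
  \det (\matrix_(i, j) ((v i : {classic L}) == w j)%:R).

Lemma chainP K n (c : tuplefun n) : reflect
  [/\ finite_set [set v | c v <> 0],
      forall (s : 'S_n.+1) v, c (v \o s) = (-1) ^+ s * c v
    & forall v, c v <> 0 -> injective v /\ K (range v)] (c \in chains K n).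
Proof. exact: asboolP. Qed.

Lemma chain_closed K n : submod_closed (chains K n).
Proof.
split=> [|a c d /chainP[cfin calt cK] /chainP[dfin dalt dK]].
  apply/chainP; split=> [|s v|//]; last by rewrite mulr0.
  by rewrite (_ : [set _ | _] = set0) // -subset0 => v /=.
have cd v : (a *: c + d) v <> 0 -> c v <> 0 \/ d v <> 0.
  move=> cdv; have [cv|] := pselect (c v = 0); [right|by left].
  by move=> dv; apply: cdv; rewrite !fctE /= cv dv scaler0 addr0.
apply/chainP; split=> [|s v|v /cd[/cK|/dK]//].
  by apply: sub_finite_set cd _; rewrite finite_setU.
have acdE w : (a *: c + d) w = a * c w + d w by [].
by rewrite !acdE calt dalt mulrDr mulrCA.
Qed.

HB.instance Definition _ K n :=
  GRing.isSubmodClosed.Build k (tuplefun n) (chains K n) (chain_closed K n).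

Lemma fcons0 n x (v : 'I_n.+1 -> L) : fcons x v ord0 = x.
Proof. by rewrite /fcons unlift_none. Qed.

Lemma fcons_lift n x (v : 'I_n.+1 -> L) i : fcons x v (lift ord0 i) = v i.
Proof. by rewrite /fcons liftK. Qed.

Definition vertices_in n (c : tuplefun n) (r : seq {classic L}) :=
  uniq r /\ forall v i, c v <> 0 -> (v i : {classic L}) \in r.

Lemma boundaryE n (c : tuplefun n.+1) r v : vertices_in c r ->
  simplicial_boundary c v = \sum_(x <- r) c (fcons x v).
Proof.
move=> [ur cr]; rewrite fsbig_seq //; apply/esym/fsbig_widen => // x [_ /= rx].
by apply: contra_notP rx => cx; rewrite -(fcons0 x v); exact: cr.
Qed.

Lemma chain_vertices n (S : set ('I_n.+1 -> L)) : finite_set S ->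
  exists2 r : seq {classic L}, uniq r &
    forall v i, S v -> (v i : {classic L}) \in r.
Proof.
move=> Sfin; have : finite_set (\bigcup_(v in S) range v : set {classic L}).
  by apply: bigcup_finite => // v _; exact/finite_image/finite_finset.
case/finite_seqP => r rE; exists (undup r); first exact: undup_uniq.
move=> v i Sv; rewrite mem_undup.
by have : [set` r] (v i : {classic L}) by rewrite -rE; exists v.
Qed.

Lemma chain_vertices1 K n c : c \in chains K n -> exists r, vertices_in c r.
Proof.
by move=> /chainP[/chain_vertices[r ur cr] _ _]; exists r.
Qed.

Lemma boundary_linear K n a c d : c \in chains K n.+1 -> d \in chains K n.+1 ->
  simplicial_boundary (a *: c + d) =
  a *: simplicial_boundary c + simplicial_boundary d.
Proof.
move=> /chainP[cfin _ _] /chainP[dfin _ _].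
have [r ur cdr] : exists2 r : seq {classic L}, uniq r & forall v i,
    ([set v | c v <> 0] `|` [set v | d v <> 0]) v -> (v i : {classic L}) \in r.
  by apply: chain_vertices; rewrite finite_setU.
have cr : vertices_in c r by split=> // v i cv; apply: cdr; left.
have dr : vertices_in d r by split=> // v i dv; apply: cdr; right.
have acdr : vertices_in (a *: c + d) r.
  split=> // v i acdv; apply: cdr.
  have [cv|] := pselect (c v = 0); [right|by left].
  by move=> dv; apply: acdv; rewrite !fctE /= cv dv scaler0 addr0.
apply/funext => v; rewrite (boundaryE _ acdr).
transitivity (a *: simplicial_boundary c v + simplicial_boundary d v);
  last by [].
by rewrite (boundaryE _ cr) (boundaryE _ dr) scaler_sumr -big_split.
Qed.

Lemma boundary_neq0 n (c : tuplefun n.+1) v : simplicial_boundary c v <> 0 ->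
  exists x, c (fcons x v) <> 0.
Proof.
apply: contra_notP => /forallNP cv; apply: fsbig1 => x _.
exact: contrapT (cv x).
Qed.

Lemma boundary_chain (K : simplicial_complex L) n c :
  c \in chains K n.+1 -> simplicial_boundary c \in chains K n.
Proof.
move=> /chainP[cfin calt cK]; apply/chainP; split=> [|s v|v].
- apply: sub_finite_set; last first.
    exact: (finite_image (fun (w : 'I_n.+2 -> L) (i : 'I_n.+1) =>
      w (lift ord0 i)) cfin).
  move=> v /= /boundary_neq0[x cx]; exists (fcons x v) => //.
  by apply/funext => i /=; rewrite fcons_lift.
- rewrite /simplicial_boundary (mulr_fsumr (R := k)); apply: eq_fsbigr => x _.
  rewrite -[X in _ = X * _](_ : (-1) ^+ lift_perm ord0 ord0 s = _).
    rewrite -calt; congr c; apply/funext => i /=.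
    case: (unliftP ord0 i) => [j ->|->].
      by rewrite lift_perm_lift !fcons_lift.
    by rewrite lift_perm_id !fcons0.
  by rewrite odd_lift_perm.
- move=> /boundary_neq0[x /cK[xinj xK]]; split=> [i j vij|].
    by apply/(@lift_inj _ ord0)/xinj; rewrite !fcons_lift.
  apply: simplex_face xK _ _ => [_ [i _ <-]|].
    by exists (lift ord0 i) => //; rewrite fcons_lift.
  by exists (v ord0), ord0.
Qed.

Lemma sum_antisym (T : eqType) (r : seq T) (g : T -> T -> k) :
  (forall x, g x x = 0) -> (forall x y, g x y = - g y x) ->
  \sum_(x <- r) \sum_(y <- r) g x y = 0.
Proof.
move=> g0 gN; elim: r => [|x r IH]; first by rewrite big_nil.
rewrite big_cons big_cons g0 add0r.
under [X in _ + X]eq_bigr do rewrite big_cons.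
rewrite big_split /= IH addr0 -big_split big1 //= => y _.
by rewrite gN addNr.
Qed.

Lemma boundary_boundary (K : simplicial_complex L) n c : c \in chains K n.+2 ->
  simplicial_boundary (simplicial_boundary c) = 0.
Proof.
move=> cK; have [r cr] := chain_vertices1 cK.
have bcr : vertices_in (simplicial_boundary c) r.
  split=> [|v i /boundary_neq0[x cx]]; first by case: cr.
  by rewrite -(fcons_lift x v); apply: cr.2.
move: cK => /chainP[_ calt cK].
apply/funext => v; rewrite (boundaryE _ bcr).
under eq_bigr do rewrite (boundaryE _ cr).
apply: sum_antisym => [x|x y].
  apply: contrapT => /cK[+ _] => /(_ ord0 (lift ord0 ord0)).
  by rewrite fcons_lift !fcons0 => /(_ erefl).
have := calt (tperm ord0 (lift ord0 ord0))
  (fcons x (fcons y v)).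
rewrite odd_tperm neq_lift expr1 mulN1r => <-; congr c.
apply/funext => i /=; case: (unliftP ord0 i) => [j ->|->]; last first.
  by rewrite tpermL fcons_lift !fcons0.
case: (unliftP ord0 j) => [l ->|->]; last by rewrite tpermR fcons_lift !fcons0.
by rewrite tpermD ?fcons_lift // ?neq_lift.
Qed.

Lemma ochain_perm n (v w : 'I_n.+1 -> L) : ochain v w <> 0 ->
  exists s : 'S_n.+1, w = v \o s.
Proof.
move=> /eqP vw; suff [s /forallP vws] : exists s : 'S_n.+1,
    [forall i, (v i : {classic L}) == w (s i)].
  exists (s^-1)%g; apply/funext => i /=.
  by rewrite (eqP (vws _)) permKV.
apply/existsP; apply: contraR vw => /existsPn vw.
rewrite /ochain /determinant big1 // => s _.
have /forallPn[i /negPf vwi] := vw s.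
by rewrite (bigD1 i) //= mxE vwi mul0r mulr0.
Qed.

Lemma ochain_chain (K : set (set L)) n (v : 'I_n.+1 -> L) :
  injective v -> K (range v) -> ochain v \in chains K n.
Proof.
move=> vinj vK; apply/chainP; split=> [|s w|w /ochain_perm[s ->]].
- apply: sub_finite_set; last first.
    exact: (finite_image (fun s : 'S_n.+1 => v \o s) (@finite_finset _ setT)).
  move=> w /= /ochain_perm[s ->].
  by exists s.
- rewrite -odd_permV mulrC -det_perm -det_mulmx -col_permE; congr (\det _).
  by apply/matrixP => i j; rewrite !mxE.
- split; first exact: inj_comp vinj perm_inj.
  rewrite (_ : range _ = range v) //; apply/seteqP; split=> _ [i _ <-] /=.
    by exists (s i).
  by exists ((s^-1)%g i) => //=; rewrite permKV.
Qed.

Lemma ochain_id n (v : 'I_n.+1 -> L) : injective v -> ochain v v = 1.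
Proof.
move=> vinj; rewrite -(det1 k n.+1); congr (\det _).
apply/matrixP => i j; rewrite !mxE.
by rewrite (inj_eq (vinj : injective (v : _ -> {classic L}))).
Qed.

Lemma boundary_ochain n (v : 'I_n.+2 -> L) :
  simplicial_boundary (ochain v) =
  \sum_(i < n.+2) (-1) ^+ i *: ochain (fun j : 'I_n.+1 => v (lift i j)).
Proof.
pose r := undup (codom (v : _ -> {classic L})).
have rv i : (v i : {classic L}) \in r by rewrite mem_undup; exact: codom_f.
have vr : vertices_in (ochain v) r.
  split=> [|u i /ochain_perm[s ->]]; first exact: undup_uniq.
  exact: (rv (s i)).
apply/funext => w; rewrite fct_sumE (boundaryE _ vr).
pose D i := cofactor (\matrix_(i, j)
  ((v i : {classic L}) == fcons (v ord0) w j)%:R : 'M[k]_n.+2) i ord0.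
transitivity (\sum_(x <- r) \sum_i ((v i : {classic L}) == x)%:R * D i).
  apply: eq_bigr => x _; rewrite /ochain (expand_det_col _ ord0).
  apply: eq_bigr => i _; rewrite mxE fcons0; congr (_ * (_ * \det _)).
  by apply/matrixP => a b; rewrite !mxE !fcons_lift.
rewrite exchange_big /=; apply: eq_bigr => i _.
rewrite -big_distrl /= (bigD1_seq (v i : {classic L})) ?undup_uniq //=.
rewrite eqxx big1 ?addr0 ?mul1r => [|x /negPf]; last by rewrite eq_sym => ->.
rewrite /D /cofactor addn0; congr (_ * \det _).
by apply/matrixP => a b; rewrite !mxE !fcons_lift.
Qed.

End Chains.

Arguments chains k {L} K n.

Section Homology.
Variables (k : fieldType) (L : Type).
Implicit Types K : simplicial_complex L.

Definition cycles K n : {pred ('I_n.+1 -> L) -> k^o} :=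
  if n is m.+1 return {pred ('I_n.+1 -> L) -> k^o}
  then fun c => (c \in chains k K m.+1) && (simplicial_boundary c == 0)
  else chains k K 0.
Arguments cycles : clear implicits.

Definition boundaries K n : {pred ('I_n.+1 -> L) -> k^o} :=
  fun c => `[< exists2 d, d \in chains k K n.+1 & c = simplicial_boundary d >].
Arguments boundaries : clear implicits.

Lemma cycles_closed K n : submod_closed (cycles K n).
Proof.
case: n => [|n]; first exact: @chain_closed k L K 0.
have [c0 cD] := @chain_closed k L K n.+1.
have b0 : simplicial_boundary (0 : ('I_n.+2 -> L) -> k^o) = 0.
  by apply/funext => v; rewrite /simplicial_boundary fsbig1.
split=> [|a c d /andP[cK /eqP bc] /andP[dK /eqP bd]].
  by apply/andP; split=> //; apply/eqP.
apply/andP; split; first exact: cD.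
by rewrite (boundary_linear a cK dK) bc bd scaler0 addr0.
Qed.

Lemma boundaries_closed K n : submod_closed (boundaries K n).
Proof.
have [c0 cD] := @chain_closed k L K n.+1.
split=> [|a _ _ /asboolP[c cK ->] /asboolP[d dK ->]].
  apply/asboolP; exists 0 => //.
  by apply/funext => v; rewrite /simplicial_boundary fsbig1.
apply/asboolP; exists (a *: c + d); first exact: cD.
by rewrite (boundary_linear a cK dK).
Qed.

HB.instance Definition _ K n :=
  GRing.isSubmodClosed.Build k _ (cycles K n) (cycles_closed K n).
HB.instance Definition _ K n :=
  GRing.isSubmodClosed.Build k _ (boundaries K n) (boundaries_closed K n).

Lemma boundaries_cycles K n : {subset boundaries K n <= cycles K n}.
Proof.
move=> _ /asboolP[c cK ->]; case: n c cK => [|n] c cK.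
  exact: boundary_chain cK.
apply/andP; split; first exact: boundary_chain cK.
by rewrite (boundary_boundary cK).
Qed.

Definition homology_deg K n : lmodType k :=
  subquot (cycles K n : submodClosed _) (boundaries K n : submodClosed _).

Definition homology K : lmodType k := dsum (homology_deg K).

Section Induced.
Variables K K' : simplicial_complex L.
Hypothesis KK' : K `<=` K'.

Lemma chain_sub n : {subset chains k K n <= chains k K' n}.
Proof.
move=> c /chainP[cfin calt cK]; apply/chainP; split=> // v /cK[vinj vK].
by split=> //; exact: KK'.
Qed.

Lemma cycles_sub n : {subset cycles K n <= cycles K' n}.
Proof.
case: n => [|n] c; first exact: chain_sub.
by move=> /andP[cK bc]; apply/andP; split; first exact: chain_sub.
Qed.

Lemma boundaries_sub n : {subset boundaries K n <= boundaries K' n}.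
Proof.
by move=> _ /asboolP[c cK ->]; apply/asboolP; exists c => //; exact: chain_sub.
Qed.

Definition homology_deg_map n :
    {linear homology_deg K n -> homology_deg K' n} :=
  subquot_map (@cycles_sub n) (@boundaries_sub n).

Definition homology_map : {linear homology K -> homology K'} :=
  dsum_map homology_deg_map.

End Induced.

Lemma homology_map_id K (KK : K `<=` K) (x : homology K) :
  homology_map KK x = x.
Proof.
apply: dsumP => n /=; rewrite -[RHS]subquot_pi_repr.
by congr subquot_pi; exact: val_inj.
Qed.

Lemma homology_map_comp K1 K2 K3 (K12 : K1 `<=` K2) (K23 : K2 `<=` K3)
    (K13 : K1 `<=` K3) (x : homology K1) :
  homology_map K23 (homology_map K12 x) = homology_map K13 x.
Proof.
apply: dsumP => n /=.
have [z ->] : exists z, x n = subquot_pi _ z.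
  by eexists; exact/esym/subquot_pi_repr.
rewrite !(subquot_map_pi _ _ z) subquot_map_pi.
by congr (subquot_pi _ _); exact: val_inj.
Qed.

End Homology.

Record persistence_module (R : realType) (k : fieldType) := PersistenceModule {
  pm_space :> R -> lmodType k;
  pm_map : forall a b : R, a <= b -> {linear pm_space a -> pm_space b};
  pm_map_id : forall a (aa : a <= a) x, pm_map aa x = x;
  pm_map_comp : forall a b c (ab : a <= b) (bc : b <= c) (ac : a <= c) x,
    pm_map bc (pm_map ab x) = pm_map ac x }.

(* rank < oo: the image is spanned by finitely many of its elements *)
Definition finite_rank (k : fieldType) (V W : lmodType k)
    (f : {linear V -> W}) : Prop :=
  exists (n : nat) (e : 'I_n -> W), (forall i, range f (e i)) /\
    forall y, range f y -> exists a : 'I_n -> k, y = \sum_i a i *: e i.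

Definition q_tame (R : realType) (k : fieldType)
    (M : persistence_module R k) : Prop :=
  forall (a b : R) (ab : a < b), finite_rank (pm_map M (ltW ab)).

Section Dowker.
Variables (R : realType) (L W : Type) (Lambda : L -> W -> R).

Definition dowker_simplices (a : R) : set (set L) := fun s =>
  [/\ finite_set s, s !=set0 & exists w, forall l, s l -> Lambda l w <= a].

Lemma dowker_face a s t : dowker_simplices a s -> t `<=` s -> t !=set0 ->
  dowker_simplices a t.
Proof.
move=> [sfin _ [w sw]] ts t0; split=> //; first exact: sub_finite_set sfin.
by exists w => l /ts/sw.
Qed.

Definition dowker (a : R) : simplicial_complex L :=
  @SimplicialComplex L (dowker_simplices a)
    (fun s '(And3 fin _ _) => fin) (fun s '(And3 _ s0 _) => s0)
    (@dowker_face a).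

Lemma dowker_sub a b : a <= b -> dowker a `<=` dowker b.
Proof.
move=> ab s [sfin s0 [w sw]]; split=> //; exists w => l /sw.
by move=> /le_trans; apply.
Qed.

Definition dowker_homology (k : fieldType) : persistence_module R k :=
  @PersistenceModule R k (fun a => homology k (dowker a))
    (fun a b ab => homology_map k (dowker_sub ab))
    (fun a aa => homology_map_id (dowker_sub aa))
    (fun a b c ab bc ac =>
       homology_map_comp (dowker_sub ab) (dowker_sub bc) (dowker_sub ac)).

End Dowker.

Section SupNorm.
Variables (R : realType) (L W : Type).
Implicit Types (f : W -> R) (F : L -> W -> R).

(* The supremum norm on all functions W -> R, +oo for unbounded ones; 0 is
   included in the supremum so that it is 0 when W is empty. *)
Definition sup_norm f : \bar R :=
  ereal_sup ([set 0%E] `|` range (fun w => `|f w|%:E)).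

Definition bounded_family F : Prop :=
  exists M : R, forall l, (sup_norm (F l) <= M%:E)%E.

Definition totally_bounded_family F : Prop :=
  forall eps : R, 0 < eps -> exists2 S : set L, finite_set S &
    forall l, exists2 l', S l' & (sup_norm (F l \- F l')%R < eps%:E)%E.

End SupNorm.

(* Main.v *)
Require Import Defs.
From mathcomp Require Import all_boot all_order all_fingroup all_algebra.
From mathcomp Require Import boolp classical_sets functions.
From mathcomp Require Import cardinality fsbigop reals ereal.

(** Let [a < b], and let [S] be a finite subset of [L] such that each
    [lambda_x] lies within [b - a] of some [lambda_y] with [y] in [S].  Lower
    [Lambda] by [b - a] on the rows indexed by [S]; at level [a], this modified
    function has a Dowker complex [K1] which lies between [Dow(Lambda, a)] and
    [Dow(Lambda, b)].  If a simplex of [K1] has a vertex [x] outside [S], and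
    [y] in [S] is close to [x], then the witness of the simplex also admits
    [y]: the vertex [x] is dominated by [y] in [K1].

    A dominated vertex can be removed from the support of any cycle [c] up to
    homology.  With [c_x] the part of [c] on the simplices that contain [x],
    the boundary of [y /\ c_x] agrees with [c] on all simplices that contain
    [x] ([boundary_star_cone]), so that subtracting it leaves a homologous cycle
    without [x], whose vertices are [y] and vertices of [c].  Since a cycle has
    finitely many vertices, repeating this makes it homologous in [K1] to a
    cycle supported on [S] ([cycle_push]).  Removing vertices one by one takes
    the place of the prism operator of the contiguous maps inclusion and
    nearest point of [S], which on oriented chains requires an ordering of the
    vertices.

    The image of the homology of [Dow(Lambda, a)] in that of [Dow(Lambda, b)] is
    therefore represented by cycles supported on the finite set [S].  These
    vanish in degrees [#|S|] and above, so they are determined by finitely many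
    coefficients, which bounds the rank of the total homology map
    ([finite_rank_homology_map]). *)

Set Implicit Arguments.
Unset Strict Implicit.
Unset Printing Implicit Defensive.

Import Order.TTheory GRing.Theory Num.Theory.

Local Open Scope classical_set_scope.
Local Open Scope ring_scope.

(** * Permutations *)

Lemma lift_perm_decomp n (s : 'S_n.+1) i :
  exists t : 'S_n, s = lift_perm i (s i) t.
Proof.
have si j : s i != s (lift i j) by rewrite (inj_eq perm_inj) neq_lift.
pose f j := odflt j (unlift (s i) (s (lift i j))).
have fE j : lift (s i) (f j) = s (lift i j).
  by rewrite /f; case: (unlift_some (si j)) => l -> ->.
have finj : injective f.
  by move=> j l /(congr1 (lift (s i))); rewrite !fE => /perm_inj /lift_inj.
exists (perm finj); apply/permP => j.
by case: (unliftP i j) => [l ->|->]; rewrite ?lift_perm_id //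
  lift_perm_lift permE fE.
Qed.

(** * Linear relations with finite-dimensional source *)

Section LinearRelation.
Variables (k : fieldType) (V : lmodType k) (N : nat).
Variable Rel : 'rV[k]_N -> V -> Prop.
Hypotheses (Rel0 : Rel 0 0)
  (RelP : forall a u v x y, Rel u x -> Rel v y -> Rel (a *: u + v) (a *: x + y))
  (Rel_fun : forall y, Rel 0 y -> y = 0).

(** Choose elements of the relation whose coordinate rows form a matrix of
    maximal rank.  Maximality puts the coordinate row of any other element in
    the row space, and [Rel_fun] transports that linear combination to [V].
    Working with a relation avoids constructing the intermediate vector space
    of coordinate vectors, and yields generators that belong to the range. *)
Lemma linear_relation_fin_span : exists (n : nat) (e : 'I_n -> V),
  (forall i, exists u, Rel u (e i)) /\
  forall u y, Rel u y -> exists a : 'I_n -> k, y = \sum_i a i *: e i.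
Proof.
pose P r := `[< exists m (A : 'M[k]_(m, N)) (e : 'I_m -> V),
  (forall i, Rel (row i A) (e i)) /\ \rank A = r >].
have P0 : exists r, P r.
  exists 0%N; apply/asboolP; exists 0%N, 0, (fun=> 0).
  by split; [case|exact: mxrank0].
have Pub r : P r -> (r <= N)%N.
  by move=> /asboolP[m [A [e [_ <-]]]]; exact: rank_leq_col.
have [r /asboolP[m [A [e [Ae rA]]]] rmax] := ex_maxnP P0 Pub.
exists m, e; split=> [i|u y uy]; first by exists (row i A).
have /submxP[D uE] : (u <= A)%MS.
  apply: contrapT => uA.
  suff : P (\rank (col_mx A u)).
    move=> /rmax; rewrite -rA -addsmxE => rle.
    have /= [_ /esym] := mxrank_leqif_sup (addsmxSl A u).
    rewrite eqn_leq rle mxrankS ?addsmxSl //= => Auu; apply: uA.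
    exact: submx_trans (addsmxSr A u) Auu.
  apply/asboolP; exists (m + 1)%N, (col_mx A u),
    (fun i => if fintype.split i is inl j then e j else y); split=> // i.
  case: splitP => j ij.
    by rewrite (_ : i = lshift 1 j) ?rowKu //; exact/val_inj.
  rewrite (_ : i = rshift m j); last exact/val_inj.
  by rewrite rowKd row_id.
exists (D 0); apply/eqP; rewrite -subr_eq0; apply/eqP/Rel_fun.
have comb : Rel (D *m A) (\sum_i D 0 i *: e i).
  rewrite mulmx_sum_row.
  elim/big_ind2: _ => //.
  - by move=> u1 x1 u2 x2 /RelP H /H; move/(_ 1); rewrite !scale1r.
  - by move=> i _; have := RelP (D 0 i) (Ae i) Rel0; rewrite !addr0.
by have := RelP (-1) comb uy; rewrite -uE !scaleN1r addNr addrC.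
Qed.

End LinearRelation.

(** * Coning off the star of a dominated vertex *)

Section StarCone.
Variables (k : fieldType) (L : Type).
Implicit Types (x y : L) (K : simplicial_complex L).

(** The chain [y /\ c_x], where [c_x] is the part of [c] carried by simplices
    containing [x]: an exterior product, read off on coefficients.  For
    [y <> x] the condition that a simplex contains [x] can be tested before or
    after adding [y], and is tested here on [w]. *)
Definition star_cone n x y (c : ('I_n.+1 -> L) -> k^o) :
    ('I_n.+2 -> L) -> k^o := fun w =>
  `[< range w x >]%:R *
  \sum_(i < n.+2) (-1) ^+ i * (`[< w i = y >]%:R * c (w \o lift i)).

Lemma star_cone_neq0 n x y (c : ('I_n.+1 -> L) -> k^o) w :
  star_cone x y c w <> 0 ->
  range w x /\ exists2 i, w i = y & c (w \o lift i) <> 0.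
Proof.
rewrite /star_cone; case: asboolP => [xw|_]; last by rewrite mul0r.
rewrite mul1r => sw; split=> //; apply: contrapT => nw; apply: sw.
apply: big1 => i _; case: asboolP => [wi|_]; last by rewrite mul0r mulr0.
rewrite mul1r (_ : c _ = 0) ?mulr0 //; apply: contrapT => cw; apply: nw.
by exists i.
Qed.

Lemma comp_perm_lift n (w : 'I_n.+2 -> L) i j t :
  (w \o lift_perm i j t) \o lift i = (w \o lift j) \o t.
Proof. by apply/funext => l /=; rewrite lift_perm_lift. Qed.

(** A permutation [s] splits at [i] as the move of [i] to [s i] and a
    permutation of the other positions, so that [s] reindexes the expansion
    over the position of [y]. *)
Lemma star_cone_alt K n x y (c : ('I_n.+1 -> L) -> k^o) :
  c \in chains k K n -> forall (s : 'S_n.+2) w,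
  star_cone x y c (w \o s) = (-1) ^+ s * star_cone x y c w.
Proof.
move=> /chainP[_ calt _] s w; rewrite /star_cone.
have -> : range (w \o s) = range w.
  apply/seteqP; split=> _ [i _ <-] /=; first by exists (s i).
  by exists ((s^-1)%g i) => //=; rewrite permKV.
rewrite mulrCA; congr (_ * _).
rewrite [X in _ = _ * X](reindex_inj (@perm_inj _ s)).
rewrite mulr_sumr; apply: eq_bigr => i _ /=.
have [t sE] := lift_perm_decomp s i.
rewrite {2}sE comp_perm_lift calt !mulrA; congr (_ * _).
rewrite mulrAC; congr (_ * _).
rewrite {1}sE odd_lift_perm -(signr_odd _ i) -(signr_odd _ (s i)) -!signr_addb.
by rewrite addbAC addbK.
Qed.

Lemma exists_perm2 n (a b : 'I_n.+2) : a != b ->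
  exists s : 'S_n.+2, s ord0 = a /\ s (lift ord0 ord0) = b.
Proof.
move=> ab; pose b' := tperm ord0 a b.
exists (tperm (lift ord0 ord0) b' * tperm ord0 a)%g; rewrite !permM tpermL.
split; last by rewrite /b' tpermK.
have b0 : b' != ord0.
  by rewrite -(inj_eq (@perm_inj _ (tperm ord0 a))) tpermL /b' tpermK eq_sym.
by rewrite (tpermD _ b0) ?tpermL // eq_sym neq_lift.
Qed.

(** In characteristic 2 alternation alone does not force a coefficient with
    repeated vertices to vanish.  Once the repetition is moved to positions 0
    and 1, the first two terms cancel, and each of the others is a coefficient
    of [c] that still has the repetition. *)
Lemma star_cone_inj K n x y (c : ('I_n.+1 -> L) -> k^o) w :
  c \in chains k K n -> star_cone x y c w <> 0 -> injective w.
Proof.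
move=> cK sw a b wab; apply: contrapT => /eqP /exists_perm2[s [sa sb]].
apply: sw; have := star_cone_alt x y cK s w.
set v := w \o s => /(congr1 ( *%R ((-1) ^+ s))).
rewrite mulrA -expr2 sqrr_sign mul1r => <-.
have v01 : v ord0 = v (lift ord0 ord0) by rewrite /v /= sa sb.
rewrite /star_cone big_ord_recl big_ord_recl big1 ?addr0 => [|i _].
  rewrite v01 (_ : (-1) ^+ lift ord0 ord0 = -1) // expr0 mul1r mulN1r.
  rewrite (_ : v \o lift (lift ord0 ord0) = v \o lift ord0) ?subrr ?mulr0 //.
  apply/funext => j /=; have [->|j0] := eqVneq j ord0.
    rewrite -v01; congr v; exact/val_inj.
  congr v; apply/val_inj => /=; rewrite /bump /=.
  by case: j j0 => [[|j] ?].
rewrite (_ : c _ = 0) ?mulr0 //; apply: contrapT.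
move/chainP: cK => [_ _ cK] /cK[vinj _].
set i2 := lift ord0 (lift ord0 i) in vinj.
have [p0 p0E] : exists j, lift i2 j = ord0.
  have := @neq_lift _ ord0 (lift ord0 i).
  by rewrite eq_sym => /unlift_some[j]; exists j.
have [p1 p1E] : exists j, lift i2 j = lift ord0 ord0.
  have : i2 != lift ord0 ord0 by rewrite (inj_eq lift_inj) eq_sym neq_lift.
  by move=> /unlift_some[j]; exists j.
have /vinj : (v \o lift i2) p0 = (v \o lift i2) p1 by rewrite /= p0E p1E.
move=> /(congr1 (lift i2)); rewrite p0E p1E => /eqP.
by rewrite (negPf (neq_lift _ _)).
Qed.

(** The closed star of [x] in [K] is a cone with apex [y]. *)
Definition dominated K x y :=
  forall s, simplex K s -> s x -> simplex K (y |` s).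

(** Domination is what keeps the cone inside [K]. *)
Lemma star_cone_chain K n x y c : x <> y -> dominated K x y ->
  c \in chains k K n -> star_cone x y c \in chains k K n.+1.
Proof.
move=> xy Kxy cKn; move: (cKn) => /chainP[cfin _ cK].
apply/chainP; split=> [||w sw]; [|exact: star_cone_alt cKn|].
  (* A tuple in the support is determined by the position of [y] and the
     other vertices, which carry a nonzero coefficient of [c]. *)
  pose ins i (v : 'I_n.+1 -> L) : 'I_n.+2 -> L := fun j =>
    if unlift i j is Some l then v l else y.
  apply: (@sub_finite_set _ _ (\bigcup_i ins i @` [set v | c v <> 0])).
    move=> w /star_cone_neq0[_ [i wi ci]]; exists i => //.
    exists (w \o lift i) => //; apply/funext => j; rewrite /ins.
    by case: unliftP => [l|] ->.
  apply: bigcup_finite => [|i _]; first exact: finite_finset.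
  exact: finite_image.
split; first exact: star_cone_inj cKn sw.
have [[j _ wj] [i wi /cK[_ Kw]]] := star_cone_neq0 sw.
have -> : range w = y |` range (w \o lift i).
  apply/seteqP; split=> [_ [l _ <-]|_ [->|[l _ <-]]].
  - by case: (unliftP i l) => [m|] ->; [right; exists m|left].
  - by exists i.
  - by exists (lift i l).
apply: Kxy => //; case: (unliftP i j) => [m jE|jE]; last first.
  by case: xy; rewrite -wj jE.
by exists m => //=; rewrite -jE.
Qed.

Lemma cycles_chains K n :
  {subset @cycles k L K n <= chains k K n}.
Proof. by case: n => [|n] c // /andP[]. Qed.

(** Expand the boundary over the new vertex [z] and the position of [y].  If
    [y] is the new vertex, then [c v] remains.  If [y] is a vertex of [v], then
    the sum over [z] is a coefficient of the boundary of [c], so it vanishes;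
    this is where [c] being a cycle is used.  In degree 0 that second case does
    not occur, since the only vertex of [v] is [x]. *)
Lemma boundary_star_cone K n x y (c : ('I_n.+1 -> L) -> k^o) v :
  x <> y -> c \in @cycles k L K n -> range v x ->
  simplicial_boundary (star_cone x y c) v = c v.
Proof.
move=> xy cZ xv.
have cK := cycles_chains cZ.
have [r0 [_ cr0]] := chain_vertices1 cK.
pose r := undup ((y : {classic L}) :: r0).
have cr : vertices_in c r.
  split=> [|u i cu]; first exact: undup_uniq.
  by rewrite mem_undup inE cr0 ?orbT.
have hr : vertices_in (star_cone x y c) r.
  split=> [|w i /star_cone_neq0[_ [j wj cw]]]; first exact: undup_uniq.
  rewrite mem_undup inE; case: (unliftP j i) => [l|] ->.
    by rewrite (cr0 (w \o lift j)) ?orbT.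
  by rewrite wj eqxx.
rewrite (boundaryE v hr).
have rngE z : `[< range (fcons z v) x >] = true.
  case: xv => j _ vj; apply/asboolP.
  by exists (lift ord0 j); rewrite ?fcons_lift.
under eq_bigr => z _.
  rewrite /star_cone rngE mul1r big_ord_recl expr0 mul1r fcons0.
  rewrite (_ : fcons z v \o lift ord0 = v); last first.
    by apply/funext => j /=; rewrite fcons_lift.
  over.
rewrite big_split /= -big_distrl /=.
rewrite (_ : \sum_(z <- r) _ = 1) ?mul1r; last first.
  rewrite (bigD1_seq (y : {classic L})) ?undup_uniq ?mem_undup ?mem_head //=.
  rewrite asboolT // big1 ?addr0 // => z /eqP zy.
  by rewrite asboolF.
rewrite exchange_big /= big1 ?addr0 // => i _.
under eq_bigr do rewrite fcons_lift.
case: asboolP => [viy|_]; last by apply: big1 => z _; rewrite mul0r mulr0.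
rewrite -big_distrr /= -big_distrr /= mul1r.
(* From here on [y] is the vertex of [v] at position [i]. *)
case: n => [|n] in c v i cZ {cK} cr xv viy {hr rngE} {cr0} *.
  by case: xv => j _; rewrite (ord1 j) -(ord1 i) viy => /esym.
under eq_bigr => z _.
  rewrite (_ : _ \o _ = fcons z (v \o lift i)); last first.
    apply/funext => j /=; case: (unliftP ord0 j) => [l ->|->]; last first.
      by rewrite fcons0 (_ : lift _ _ = ord0) ?fcons0 //; exact/val_inj.
    rewrite fcons_lift /= (_ : lift _ _ = lift ord0 (lift i l)) ?fcons_lift //.
    by apply/val_inj; rewrite /= /bump !leq0n !add1n ltnS addnS.
  over.
move: cZ => /andP[_ /eqP bc].
by rewrite -(boundaryE _ cr) bc mulr0.
Qed.

End StarCone.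

(** * Pushing cycles to a dominating set of vertices *)

Section PushCycle.
Variables (k : fieldType) (L : Type) (K : simplicial_complex L) (S : set L).
Hypothesis domS : forall x, ~ S x -> exists2 y, S y & dominated K x y.

(** Subtracting the boundary of a star cone removes one vertex outside [S]
    from the support and introduces no vertex except one of [S], so the list of
    vertices left to remove gets shorter. *)
Lemma cycle_push_vertices n (r : seq {classic L}) (c : ('I_n.+1 -> L) -> k^o) :
  c \in @cycles k L K n ->
  (forall v i, c v <> 0 -> S (v i) \/ (v i : {classic L}) \in r) ->
  exists2 d, d \in chains k K n.+1 &
    forall v i, (c - simplicial_boundary d) v <> 0 -> S (v i).
Proof.
elim: r c => [|x r IH] c cZ cr.
  exists 0; first exact: (rpred0 (chains k K n.+1)).
  move=> v i; rewrite (_ : simplicial_boundary 0 = 0) ?subr0; last first.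
    by apply/funext => w; rewrite /simplicial_boundary fsbig1.
  by case/(cr v i).
have [Sx|Sx] := pselect (S x).
  apply: IH => // v i /(cr v i)[|]; first by left.
  by rewrite inE => /orP[/eqP ->|]; [left|right].
have [y Sy Kxy] := domS Sx.
have xy : x <> y by move=> xy; apply: Sx; rewrite xy.
have cK := cycles_chains cZ.
pose h := star_cone x y c.
have hK : h \in chains k K n.+1 by exact: star_cone_chain.
have c'Z : c - simplicial_boundary h \in @cycles k L K n.
  rewrite addrC -scaleN1r; apply: (cycles_closed k K n).2 => //.
  by apply: boundaries_cycles; apply/asboolP; exists h.
have [v i|d dK dS] := IH _ c'Z.
  have [xv|xv] := pselect (range v x).
    by rewrite !fctE /h (boundary_star_cone xy cZ) // subrr.
  have [Sv|Sv] := pselect (S (v i)); first by left.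
  move=> c'v; right.
  suff : S (v i) \/ (v i : {classic L}) \in x :: r.
    by case=> //; rewrite inE => /orP[/eqP vx|//]; case: xv; exists i.
  have [cv|] := pselect (c v = 0); last exact: cr.
  have hv : simplicial_boundary h v <> 0.
    by move=> hv; apply: c'v; rewrite !fctE /= cv hv subrr.
  have [z hz] := boundary_neq0 hv.
  have [_ [j wj cw]] := star_cone_neq0 hz.
  case: (unliftP j (lift ord0 i)) => [l|] E.
    by have := cr _ l cw; rewrite /= -E fcons_lift.
  by left; rewrite -(fcons_lift z v) E wj.
exists (h + d); first exact: (@rpredD _ (chains k K n.+1)).
have -> : simplicial_boundary (h + d) =
    simplicial_boundary h + simplicial_boundary d.
  by have := boundary_linear 1 hK dK; rewrite !scale1r.
by rewrite opprD addrA.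
Qed.

Lemma cycle_push n (c : ('I_n.+1 -> L) -> k^o) : c \in @cycles k L K n ->
  exists2 d, d \in chains k K n.+1 &
    forall v i, (c - simplicial_boundary d) v <> 0 -> S (v i).
Proof.
move=> cZ; have cK := cycles_chains cZ.
have [r [_ cr]] := chain_vertices1 cK.
by apply: (@cycle_push_vertices _ r) => // v i /cr; right.
Qed.

End PushCycle.

(** * Finite rank *)

(** An ordered simplex is injective, so one with vertices in [r] has at most
    [size r] of them. *)
Lemma supported_chain_eq0 (k : fieldType) (L : Type) (K : set (set L)) n
    (r : seq {classic L}) (c : ('I_n.+1 -> L) -> k^o) :
  c \in chains k K n -> (forall v i, c v <> 0 -> (v i : {classic L}) \in r) ->
  (size r <= n)%N -> c = 0.
Proof.
move=> /chainP[_ _ cK] cr rn; apply/funext => v; apply: contrapT => cv.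
have [vinj _] := cK v cv.
suff : (n.+1 <= size r)%N by rewrite leqNgt ltnS rn.
rewrite -[n.+1]card_ord -(size_codom (v : _ -> {classic L})).
apply: uniq_leq_size => [|_ /codomP[i ->]]; last exact: cr.
by apply/injectiveP.
Qed.

(** Every class in the image is represented by a cycle of [K'] supported on
    [S]; such a cycle is determined by its finitely many coefficients on tuples
    from [S], in the finitely many degrees in which it can be nonzero. *)
Theorem finite_rank_homology_map (k : fieldType) (L : Type)
    (K K1 K' : simplicial_complex L) (S : set L)
    (KK1 : K `<=` K1) (K1K' : K1 `<=` K') (KK' : K `<=` K') :
  finite_set S -> (forall x, ~ S x -> exists2 y, S y & dominated K1 x y) ->
  finite_rank (homology_map k KK').
Proof.
move=> Sfin domS.
have [r Sr] : exists r : seq {classic L},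
    forall x, S x -> (x : {classic L}) \in r.
  have /finite_seqP[r rE] := (Sfin : @finite_set {classic L} S).
  by exists r => x; rewrite rE.
pose f := homology_map k KK'.
(* [I] indexes those coefficients, in all degrees at once. *)
pose I := {n : 'I_(size r) & {ffun 'I_n.+1 -> seq_sub r}}.
pose Rel (u : 'rV[k]_#|{: I}|) (y : homology k K') :=
  exists c : forall n, submod (cycles K' (n := n) : submodClosed _),
  [/\ range f y, (forall n, y n = subquot_pi _ (c n)),
    (forall n v i, submod_val (c n) v <> 0 -> S (v i)) &
    forall j : 'I_#|{: I}|,
      u 0 j = submod_val (c (tag (enum_val j)))
        (fun i => val (tagged (enum_val j) i))].
have Rel0 : Rel 0 0.
  exists (fun=> 0); split => //.
  - by exists 0 => //; rewrite linear0.
  - by move=> n; rewrite linear0.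
  - by move=> j; rewrite mxE.
have RelP a u v x y : Rel u x -> Rel v y -> Rel (a *: u + v) (a *: x + y).
  move=> [c [[x' _ <-] cx cS cu]] [d [[y' _ <-] dy dS dv]].
  exists (fun n => a *: c n + d n); split.
  - by exists (a *: x' + y') => //; rewrite linearP.
  - by move=> n; rewrite linearP /= -cx -dy.
  - move=> n w i /= cdw; have [cw|/cS//] := pselect (submod_val (c n) w = 0).
    have [dw|/dS//] := pselect (submod_val (d n) w = 0).
    by case: cdw; rewrite !fctE /= cw dw scaler0 addr0.
  - by move=> j; rewrite !mxE cu dv.
have Rel_fun y : Rel 0 y -> y = 0.
  move=> [c [_ cy cS c0]]; apply: dsumP => n; rewrite cy.
  rewrite (_ : c n = 0) ?linear0 //; apply/val_inj => /=.
  have cr v i : submod_val (c n) v <> 0 -> (v i : {classic L}) \in r.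
    by move=> /cS => /(_ i) /Sr.
  have [rn|nr] := leqP (size r) n.
    apply: supported_chain_eq0 cr rn.
    exact: cycles_chains (submod_valP (c n)).
  apply/funext => v; apply: contrapT => cv.
  pose i : I := Tagged (fun m : 'I_(size r) => {ffun 'I_m.+1 -> seq_sub r})
    (i := Ordinal nr) [ffun j => SeqSub (cr v j cv)].
  have := c0 (enum_rank i); rewrite enum_rankK mxE /= => cv0; apply: (cv).
  by rewrite [RHS]cv0; congr (submod_val _ _); apply/funext => j; rewrite ffunE.
have [N [e [e_rel e_span]]] := linear_relation_fin_span Rel0 RelP Rel_fun.
exists N, e; split=> [i|y yf].
  by have [u [c []]] := e_rel i.
suff [u /e_span] : exists u, Rel u y by [].
have [x _ xy] := yf.
(* In each degree, push a representative in [K] to [S] inside [K1]. *)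
have c n : {c : submod (cycles K' (n := n) : submodClosed _) |
    y n = subquot_pi _ c /\ forall v i, submod_val c v <> 0 -> S (v i)}.
  apply: cid; have [z xz] : exists z, x n = subquot_pi _ z.
    by eexists; exact/esym/subquot_pi_repr.
  have zK1 := cycles_sub KK1 (submod_valP z).
  have [d dK1 dS] := cycle_push domS zK1.
  have dB : simplicial_boundary d \in boundaries K' (n := n).
    by apply: (boundaries_sub K1K'); apply/asboolP; exists d.
  have cZ : submod_val z - simplicial_boundary d \in cycles K' (n := n).
    rewrite addrC -scaleN1r; apply: (cycles_closed k K' n).2.
      exact: boundaries_cycles.
    by have := cycles_sub K1K' zK1.
  exists (Submod cZ); split=> //.
  rewrite -xy /= xz (subquot_map_pi _ _ z); apply/subquot_piP => /=.
  by rewrite opprB addrC subrK.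
exists (\row_(j < #|{: I}|) submod_val (sval (c (tag (enum_val j))))
  (fun i => val (tagged (enum_val j) i))), (fun n => sval (c n)).
split=> // [n|n|j]; [exact: (svalP (c n)).1|exact: (svalP (c n)).2|].
by rewrite mxE.
Qed.

(** * Dowker complexes *)

Lemma sup_norm_ge (R : realType) (W : Type) (f : W -> R) w :
  (`|f w|%:E <= sup_norm f)%E.
Proof. by apply: ereal_sup_ubound; right; exists w. Qed.

Theorem proposition5p7 (R : realType) (k : fieldType) (L W : Type)
    (Lambda : L -> W -> R)
    (Lambda_bounded : bounded_family Lambda)
    (Lambda_totally_bounded : totally_bounded_family Lambda) :
  q_tame (dowker_homology Lambda k).
Proof.
move=> a b ab; have eps0 : 0 < b - a by rewrite subr_gt0.
have [S Sfin Snet] := Lambda_totally_bounded _ eps0.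
(* The vertices of the net are allowed the level [b], the others [a]. *)
pose Lambda' l w := Lambda l w - (if `[< S l >] then b - a else 0).
have KK1 : dowker Lambda a `<=` dowker Lambda' a.
  move=> s [sfin s0 [w sw]]; split=> //; exists w => l /sw.
  apply: le_trans; rewrite /Lambda'.
  by case: ifP => _; rewrite ?subr0 // gerBl ltW.
have K1K' : dowker Lambda' a `<=` dowker Lambda b.
  move=> s [sfin s0 [w sw]]; split=> //; exists w => l /sw.
  rewrite /Lambda'; case: ifP => _; first by rewrite lerBlDr subrKC.
  by rewrite subr0 => /le_trans; apply; exact: ltW.
apply: (finite_rank_homology_map k KK1 K1K' _ Sfin) => x Sx.
have [y Sy xy] := Snet x; exists y => // s [sfin _ [w sw]] sx.
split; first by rewrite finite_setU; split.
  by exists y; left.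
exists w => l [->|/sw//]; rewrite /Lambda' asboolT // lerBlDr.
have := sw x sx; rewrite /Lambda' asboolF // subr0 => xa.
have := le_lt_trans (sup_norm_ge _ w) xy; rewrite lte_fin ltr_distlC.
move=> /andP[_ /ltW yx]; apply: le_trans yx _.
by rewrite lerD2r.
Qed.
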